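(* Let $C$ be a nonempty closed convex subset of a $2$-uniformly convex and uniformly smooth real Banach space $E$ with dual $E^*$. Let $f_k:C\times C\to\mathbb{R}$, $k=1,\dots,q$, be a finite family of bifunctions satisfying (A1)--(A4) (listed in the context), and let $B_k:C\to E^*$, $k=1,\dots,q$, be a finite family of continuous monotone mappings. Let $T_j:C\to C$, $j=1,\dots,d$, be a finite family of continuous relatively nonexpansive mappings, and let $A_i:C\to E^*$, $i=1,\dots,m$, be a finite family of $\gamma_i$-inverse strongly monotone operators with constants $\gamma_i\in(0,1)$. Suppose that $$F:=\Big[\bigcap_{j=1}^d F(T_j)\Big]\cap\Big[\bigcap_{i=1}^m VI(A_i,C)\Big]\cap\Big[\bigcap_{k=1}^q GEP(f_k,B_k)\Big]\neq\emptyset .$$ Let $\{x_n\}_{n\ge 0}$ be a sequence defined by $$\left\{\begin{array}{l} x_0\in C_0=C\ \text{chosen arbitrarily},\\ z_n=\Pi_C J^{-1}(Jx_n-\lambda_nA_{n+1}x_n),\\ y_n=J^{-1}(\alpha_nJx_n+(1-\alpha_n)JT_{n+1}z_n);\quad u_{k,n}\in C,\ k=1,\dots,q,\ \text{such that}\\ f_k(u_{k,n},y)+\langle B_ky_n,y-u_{k,n}\rangle+\frac1{r_n}\langle y-u_{k,n},Ju_{k,n}-Jy_n\rangle\ge 0\quad\forall y\in C,\ k=1,\dots,q,\\ w_n=J^{-1}(\beta_1 Ju_{1,n}+\beta_2Ju_{2,n}+\cdots+\beta_qJu_{q,n}),\\ C_{n+1}=\{z\in C_n:\phi(z,w_n)\le\phi(z,x_n)\},\\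 x_{n+1}=\Pi_{C_{n+1}}(x_0),\quad n\ge 0, \end{array}\right.$$ where $A_n=A_{n(\bmod m)}$ and $T_n=T_{n(\bmod d)}$; $r_n\in[c_1,\infty)$ for all $n$, for some $c_1>0$; $\beta_k\in(0,1)$ for $k=1,\dots,q$ with $\sum_{k=1}^q\beta_k=1$; $\alpha_n\in(0,1)$ for all $n$ with $\liminf_{n\to\infty}\alpha_n(1-\alpha_n)>0$; and $\lambda_n\in[a,b]$ for all $n$, for some $0<a<b<\frac{c^2\gamma}{2}$, where $c$ is the $2$-uniform convexity constant of $E$ and $\gamma=\min_{1\le i\le m}\gamma_i$. Then the sequence $\{x_n\}$ converges strongly to a point of $F$.
   Context: $J:E\to E^*$ is the normalized duality mapping, $\langle x,Jx\rangle=\|x\|^2=\|Jx\|^2$; in the spaces considered it is single valued and bijective with inverse $J^{-1}$. $\langle\cdot,\cdot\rangle$ is the duality pairing between $E$ and $E^*$ (written in either order). $\phi:E\times E\to\mathbb{R}$ is $\phi(x,y)=\|x\|^2-2\langle x,Jy\rangle+\|y\|^2$. For a nonempty closed convex $K\subset E$, the generalized projection $\Pi_K:E\to K$ assigns to $y$ the unique minimizer of $\phi(\cdot,y)$ over $K$. $E$ is $2$-uniformly convex if its modulus of convexity satisfies $\delta_E(\epsilon)\ge \kappa\epsilon^2$ for some $\kappa>0$. The constant $c$ (''$2$-uniformly convex constant of $E$'') is the constant, $0<c<1$, for which $\|x-y\|\le\frac{2}{c^2}\|Jx-Jy\|$ for all $x,y\in E$. A mapping $A:C\to E^*$ is monotone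 if $\langle x-y,Ax-Ay\rangle\ge0$ for all $x,y\in C$, and $\gamma$-inverse strongly monotone ($\gamma>0$) if $\langle x-y,Ax-Ay\rangle\ge\gamma\|Ax-Ay\|^2$ for all $x,y\in C$. $VI(A,C)=\{u\in C:\langle Au,v-u\rangle\ge0\ \forall v\in C\}$. $F(T)$ is the set of fixed points of $T:C\to C$. A point $p\in C$ is an asymptotic fixed point of $T$ if some sequence $\{x_n\}$ in $C$ converges weakly to $p$ with $\|x_n-Tx_n\|\to0$; $\tilde F(T)$ is the set of these. $T$ is relatively nonexpansive if $F(T)\ne\emptyset$, $\phi(p,Tx)\le\phi(p,x)$ for all $x\in C$, $p\in F(T)$, and $F(T)=\tilde F(T)$. Conditions on a bifunction $f:C\times C\to\mathbb{R}$: (A1) $f(x,x)=0$ for all $x\in C$; (A2) $f(x,y)+f(y,x)\le0$ for all $x,y\in C$; (A3) for all $x,y,z\in C$, $\lim_{t\to0}f(tz+(1-t)x,y)\le f(x,y)$ ($t\in(0,1]$); (A4) for each $x\in C$, $y\mapsto f(x,y)$ is convex and lower semicontinuous. $GEP(f,B)=\{u\in C:f(u,v)+\langle Bu,v-u\rangle\ge0\ \forall v\in C\}$. Indices modulo $m$ (resp. $d$) take values in $\{1,\dots,m\}$ (resp. $\{1,\dots,d\}$), so the finite families are used cyclically.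
   Formalization: In the equilibrium step B_k y_n is replaced by B_k u_{k,n}: y_n need not lie in C, where alone B_k is defined, and even for C = E = l^2 the printed step fails (f_k = 0, B_k = shift minus its adjoint, large r_n makes x_n unbounded). *)

(* Defs.v *)
(* MathComp-Analysis, over an arbitrary realType. *)
From HB Require Import structures.
From mathcomp Require Import all_boot all_order all_algebra.
From mathcomp Require Import all_classical all_reals all_analysis.

Set Implicit Arguments.
Unset Strict Implicit.
Unset Printing Implicit Defensive.

Import Order.TTheory GRing.Theory Num.Theory numFieldNormedType.Exports.

Local Open Scope classical_set_scope.
Local Open Scope ring_scope.

Section dual_space.
Context {R : realType}.

Definition dual_pred (E : normedModType R) : {pred E -> R^o} :=
  [pred f | `[< linear f /\ continuous f >]].

Lemma dual_submod (E : normedModType R) : submod_closed (@dual_pred E).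
Proof.
split.
  apply/asboolP; split; last by move=> x; exact: cvg_cst.
  by move=> a u v; rewrite /= scaler0 addr0.
move=> a f g /asboolP[lf cf] /asboolP[lg cg]; apply/asboolP; split.
  move=> b u v; rewrite /= !fctE lf lg !scalerDr !scalerA (mulrC a b).
  by rewrite -!addrA; congr (_ + _); rewrite addrCA.
move=> x; apply: (@continuousD _ R^o E (a *: f) g x); last exact: cg.
by apply: continuousZl_tmp; exact: cf.
Qed.

HB.instance Definition _ (E : normedModType R) :=
  GRing.isSubmodClosed.Build R (E -> R^o) (@dual_pred E) (dual_submod E).

(* E^*; the duality pairing of x : E and f : dual E is the application f x. *)
Record dual (E : normedModType R) := Dual {
  dual_fun :> E -> R^o ;
  dual_funP : dual_fun \in @dual_pred E }.

Section instances.
Variable E : normedModType R.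

HB.instance Definition _ := [isSub for @dual_fun E].
HB.instance Definition _ := [Choice of dual E by <:].
HB.instance Definition _ := [SubChoice_isSubLmodule of dual E by <:].

Lemma dual_linear (f : dual E) : linear f.
Proof. by have /asboolP[] := dual_funP f. Qed.

HB.instance Definition _ (f : dual E) :=
  GRing.isLinear.Build R E R^o *:%R f (dual_linear f).

Lemma dual_continuous (f : dual E) : continuous f.
Proof. by have /asboolP[] := dual_funP f. Qed.

Definition dual_norm (f : dual E) : R :=
  sup [set `|f x| | x in [set x : E | `|x| <= 1]].

Lemma dual_norm_has_sup (f : dual E) :
  has_sup [set `|f x| | x in [set x : E | `|x| <= 1]].
Proof.
split; first by exists `|f 0|; exists 0 => //=; rewrite normr0.
have /bounded_funP/(_ 1)[M fM] :
    bounded_near (f : {linear E -> R^o}) (nbhs (0 : E)).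
  by apply/linear_bounded_continuous; exact: dual_continuous.
by exists M => _ [x /= x1 <-]; exact: fM.
Qed.

Lemma dual_norm_ub (f : dual E) (x : E) : `|x| <= 1 -> `|f x| <= dual_norm f.
Proof.
move=> x1; apply: sup_ubound; last by exists x.
by case: (dual_norm_has_sup f).
Qed.

Lemma dual_norm_le (f : dual E) (r : R) :
  (forall x : E, `|x| <= 1 -> `|f x| <= r) -> dual_norm f <= r.
Proof.
move=> fr; apply: ge_sup; first by case: (dual_norm_has_sup f).
by move=> _ [x /= x1 <-]; exact: fr.
Qed.

Lemma dual_normD (f g : dual E) :
  dual_norm (f + g) <= dual_norm f + dual_norm g.
Proof.
apply: dual_norm_le => x x1; apply: le_trans (ler_normD _ _) _.
by apply: lerD; exact: dual_norm_ub.
Qed.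

Lemma dual_normZ_le (a : R) (f : dual E) :
  dual_norm (a *: f) <= `|a| * dual_norm f.
Proof.
apply: dual_norm_le => x x1.
by rewrite [X in `|X|]/(a * f x) normrM ler_wpM2l//; exact: dual_norm_ub.
Qed.

Lemma dual_normZ (a : R) (f : dual E) :
  dual_norm (a *: f) = `|a| * dual_norm f.
Proof.
have [->|a0] := eqVneq a 0.
  apply/eqP; rewrite eq_le dual_normZ_le normr0 mul0r.
  have /= := @dual_norm_ub (0 *: f) 0; rewrite normr0 => /(_ ler01).
  exact: le_trans.
apply/eqP; rewrite eq_le dual_normZ_le /=.
have := dual_normZ_le a^-1 (a *: f); rewrite scalerA mulVf// scale1r.
by rewrite normfV ler_pdivlMl ?normr_gt0.
Qed.

Lemma dual_norm0_eq0 (f : dual E) : dual_norm f = 0 -> f = 0.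
Proof.
move=> f0; apply/val_inj/funext => x /=.
have [->|x0] := eqVneq x 0; first exact: (linear0 (f : {linear E -> R^o})).
have nx0 : `|x| != 0 by rewrite normr_eq0.
have fx : `|f (`|x|^-1 *: x)| <= 0.
  by rewrite -f0; apply: dual_norm_ub; rewrite normrZ normfV normr_id mulVf.
move: fx; rewrite linearZ/= normrM normfV normr_id => fx.
apply/eqP; rewrite -normr_eq0 eq_le normr_ge0 andbT.
by move: fx; rewrite ler_pdivrMl ?normr_gt0// mulr0.
Qed.

HB.instance Definition _ := Lmodule_isNormed.Build R (dual E)
  dual_normD dual_normZ dual_norm0_eq0.

End instances.
End dual_space.

Section geometry.
Context {R : realType}.
Variable E : normedModType R.

(* The infimum is taken in \bar R so that it is +oo, not 0, when no such pair
   exists (that is, when E = 0). *)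
Definition modulus_convexity (eps : R) : \bar R :=
  ereal_inf [set (1 - `|2^-1 *: (p.1 + p.2)|)%:E | p in
    [set p : E * E | [/\ `|p.1| = 1, `|p.2| = 1 & eps <= `|p.1 - p.2|]]].

Definition two_uniformly_convex : Prop :=
  exists2 kappa : R, 0 < kappa &
    forall eps : R, 0 < eps -> eps <= 2 ->
      ((kappa * eps ^+ 2)%:E <= modulus_convexity eps)%E.

Definition modulus_smoothness (tau : R) : R :=
  sup [set (`|p.1 + p.2| + `|p.1 - p.2|) / 2 - 1 | p in
    [set p : E * E | `|p.1| = 1 /\ `|p.2| = tau]].

Definition uniformly_smooth : Prop :=
  modulus_smoothness tau / tau @[tau --> 0^'+] --> (0 : R).

Definition weakly_cvg (x : nat -> E) (p : E) : Prop :=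
  forall g : dual E, g (x n) @[n --> \oo] --> g p.

Definition duality_set (x : E) : set (dual E) :=
  [set f : dual E | f x = `|x| ^+ 2 /\ `|f| ^+ 2 = `|x| ^+ 2].

(* The default value 0 is never used when E is uniformly smooth and 2-uniformly
   convex: every duality_set is then a singleton and J is a bijection. *)
Definition J (x : E) : dual E := xget 0 (duality_set x).

Definition Jinv (f : dual E) : E := xget 0 [set x | J x = f].

Definition phi (x y : E) : R := `|x| ^+ 2 - 2 * J y x + `|y| ^+ 2.

(* Pi_K; the default value 0 is never used when E is 2-uniformly convex and
   uniformly smooth and K is nonempty, closed and convex. *)
Definition gproj (K : set E) (y : E) : E :=
  xget 0 [set x | K x /\ forall z, K z -> phi x y <= phi z y].

Section mappings.
Variable C : set E.
Implicit Types A B : E -> dual E.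

Definition monotone_map A : Prop :=
  forall x y, C x -> C y -> 0 <= (A x - A y) (x - y).

Definition inverse_strongly_monotone (gamma : R) A : Prop :=
  forall x y, C x -> C y -> gamma * `|A x - A y| ^+ 2 <= (A x - A y) (x - y).

Definition VI A : set E :=
  [set u | C u /\ forall v, C v -> 0 <= A u (v - u)].

Definition GEP (f : E -> E -> R) B : set E :=
  [set u | C u /\ forall v, C v -> 0 <= f u v + B u (v - u)].

Definition fixed_points (T : E -> E) : set E := [set x | C x /\ T x = x].

Definition asymptotic_fixed_points (T : E -> E) : set E :=
  [set p | C p /\ exists x : nat -> E,
    [/\ forall n, C (x n), weakly_cvg x p &
        `|x n - T (x n)| @[n --> \oo] --> (0 : R)]].

Definition relatively_nonexpansive (T : E -> E) : Prop :=
  [/\ fixed_points T !=set0,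
      forall x p, C x -> fixed_points T p -> phi p (T x) <= phi p x &
      fixed_points T = asymptotic_fixed_points T].

(* The limit as t -> 0+ is taken in \bar R, so that the value -oo is allowed. *)
Definition equilibrium_bifunction (f : E -> E -> R) : Prop :=
  [/\ forall x, C x -> f x x = 0,
      forall x y, C x -> C y -> f x y + f y x <= 0,
      forall x y z, C x -> C y -> C z ->
        exists2 l : \bar R,
          (f (t *: z + (1 - t) *: x) y)%:E @[t --> 0^'+] --> l &
          (l <= (f x y)%:E)%E &
      forall x, C x -> convex_function C (f x) /\
        lower_semicontinuous ((fun y => (f x y)%:E) : subspace C -> \bar R)].

End mappings.
End geometry.

(* A family of m objects indexed from 1 to m is indexed here by 'I_m, from 0 to
   m - 1; index n + 1 mod m in {1, .., m} is therefore n %% m in 'I_m. *)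
Definition cyc (m : nat) (m_gt0 : (0 < m)%N) (n : nat) : 'I_m :=
  Ordinal (ltn_pmod n m_gt0).

(* Main.v *)
(** The iterate [x n] is the projection of [x 0] onto decreasing closed convex
    sets, so [phi (x n) (x 0)] is monotone and bounded and [x] is Cauchy; its
    limit [l] is also the limit of [w], because
    [phi (x n.+1) (w n) <= phi (x n.+1) (x n)].  For [p] in [F] the deficit
    [phi p (x n) - phi p (w n)], which tends to 0, dominates the squared
    distances between [x n], [z n], [y n], [T (z n)] and [u k n], so all of these
    tend to [l], and [l] lies in [F] by passing to the limit.

    Two points differ from the usual argument.  No bound [|A x| <= |A x - A p|]
    is available, so the forward step uses
    [A x (p - z) = (A x - A p) (x - z) - (A x - A p) (x - p) - A p (z - p)],
    in which the last term has a sign by [VI] and the first two are at most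
    [|x - z|^2 / (4 gamma)].  And the bound on [|y - x|] and [|y - T z|] comes
    from an exact convexity identity for [phi], not from uniform convexity of the
    dual space.  Strong convexity, [c^2 / 4 |x - y|^2 <= phi x y], is the
    conjugate of the Lipschitz bound on the inverse of [J]. *)
Require Import Defs.
From HB Require Import structures.
From mathcomp Require Import all_boot all_order all_algebra.
From mathcomp Require Import all_classical all_reals all_analysis.
From mathcomp Require Import ring lra.

Set Implicit Arguments.
Unset Strict Implicit.
Unset Printing Implicit Defensive.

Import Order.TTheory GRing.Theory Num.Theory numFieldNormedType.Exports.

Local Open Scope classical_set_scope.
Local Open Scope ring_scope.

(** * Bounded linear functionals and the dual norm *)

Section dual_space_theory.
Context {R : realType} {E : normedModType R}.
Implicit Types (f g : dual E) (x y : E) (a : R).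

Lemma dualD f x y : f (x + y) = (f x : R) + (f y : R) :> R.
Proof. exact: linearD. Qed.
Lemma dualB f x y : f (x - y) = (f x : R) - (f y : R) :> R.
Proof. exact: linearB. Qed.
Lemma dualN f x : f (- x) = - (f x : R) :> R. Proof. exact: linearN. Qed.
Lemma dual0 f : f 0 = 0 :> R. Proof. exact: linear0. Qed.
Lemma dualZ f a x : f (a *: x) = a * (f x : R) :> R. Proof. exact: linearZ. Qed.

Lemma dual_addE f g x : (f + g) x = (f x : R) + (g x : R) :> R. Proof. by []. Qed.
Lemma dual_subE f g x : (f - g) x = (f x : R) - (g x : R) :> R. Proof. by []. Qed.
Lemma dual_scaleE a f x : (a *: f) x = a * (f x : R) :> R. Proof. by []. Qed.
Lemma dual_zeroE x : (0 : dual E) x = 0 :> R. Proof. by []. Qed.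

Lemma dual_sumE n (f : 'I_n -> dual E) x :
  (\sum_(i < n) f i) x = \sum_(i < n) (f i x : R) :> R.
Proof. by elim/big_rec2: _ => // i s g _ <-. Qed.

Lemma dual_ext f g : (forall x, f x = g x :> R) -> f = g.
Proof. by move=> fg; apply/val_inj/funext. Qed.

Lemma ler_dual_norm f x : `|f x : R| <= `|f| * `|x|.
Proof.
have [->|x0] := eqVneq x 0; first by rewrite dual0 !normr0 mulr0.
have nx0 : 0 < `|x| by rewrite normr_gt0.
have : `|f (`|x|^-1 *: x) : R| <= `|f|.
  by apply: dual_norm_ub; rewrite normrZ normfV normr_id mulVf// gt_eqF.
by rewrite dualZ normrM normfV normr_id ler_pdivrMl// mulrC.
Qed.

Lemma ler_dual f x : (f x : R) <= `|f| * `|x|.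
Proof. exact: le_trans (ler_norm _) (ler_dual_norm _ _). Qed.

Lemma dual_norm_le_bound f a : 0 <= a ->
  (forall x, (f x : R) <= a * `|x|) -> `|f| <= a.
Proof.
move=> a0 fa; apply: dual_norm_le => x x1; rewrite ler_norml.
have := fa x; have := fa (- x); rewrite dualN normrN.
have := ler_wpM2l a0 x1; lra.
Qed.

Lemma dual_cvg (T : Type) (F : set_system T) {FF : Filter F} f (u : T -> E) x :
  u @ F --> x -> (f (u t) : R) @[t --> F] --> (f x : R).
Proof. by move=> ux; apply: continuous_cvg => //; exact: dual_continuous. Qed.

(** A bound on one side is enough: applied at [-1 *: x] it controls [- h x], hence [|h x|], and a
    bounded linear map is continuous. This is how the derivative of the norm becomes an element of
    [dual E]. *)
Lemma exists_dual (h : E -> R) a :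
  (forall x y, h (x + y) = h x + h y) -> (forall b x, h (b *: x) = b * h x) ->
  (forall x, h x <= a * `|x|) -> exists f : dual E, forall x, f x = h x :> R.
Proof.
move=> hD hZ ha.
have lh : linear (h : E -> R^o).
  by move=> b x y; rewrite hD hZ.
have ch : continuous (h : E -> R^o).
  move=> x; apply/(@cvgrPdist_lt _ R^o) => e e0.
  have a1 : 0 < `|a| + 1 by rewrite ltr_pwDr.
  near=> y.
  have hxy : h x - h y = h (x - y).
    by rewrite -(scaleN1r y) hD hZ mulN1r.
  have hn z : `|h z| <= (`|a| + 1) * `|z|.
    rewrite ler_norml; have := ha z; have := ha (-1 *: z).
    rewrite hZ normrZ normrN1 mul1r.
    have := ler_wpM2r (normr_ge0 z) (ler_norm a); have := normr_ge0 z; lra.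
  have xy : `|x - y| < e / (`|a| + 1).
    by near: y; apply: (@cvgr_dist_lt _ E) => //; exact: divr_gt0.
  rewrite hxy; apply: le_lt_trans (hn _) _.
  by rewrite mulrC -ltr_pdivlMr.
have hP : (h : E -> R^o) \in @dual_pred R E by apply/asboolP.
by exists (Dual hP).
Unshelve. all: by end_near. Qed.

End dual_space_theory.

(** * Existence and uniqueness of the duality mapping on a smooth space *)

Section duality_map_exists.
Context {R : realType} {E : normedModType R}.
Implicit Types (x y z : E) (t : R).

(** The modulus of smoothness, a statement on unit vectors, is rescaled to an arbitrary [x != 0]:
    the second difference of the norm along [y] is small relative to the step. A single step for
    each [e] is all that the later arguments call on. *)
Lemma smooth_norm x y (e : R) : uniformly_smooth E -> x != 0 -> 0 < e ->
  exists2 t, 0 < t & `|x + t *: y| + `|x - t *: y| <= 2 * `|x| + e * t.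
Proof.
move=> sm x0 e0.
have nx0 : 0 < `|x| by rewrite normr_gt0.
have [->|y0] := eqVneq y 0.
  by exists 1 => //; rewrite scaler0 addr0 subr0; lra.
have ny0 : 0 < `|y| by rewrite normr_gt0.
have e'0 : 0 < e / (2 * `|y|) by rewrite divr_gt0// mulr_gt0.
have [tau [tau0 Htau]] : exists tau : R, 0 < tau /\
    modulus_smoothness E tau / tau < e / (2 * `|y|).
  have := @cvgr_dist_lt _ _ _ _ _ _ _ sm _ e'0 => H.
  have [tau [H1 H2]] : exists tau : R, 0 < tau /\
     `|0 - modulus_smoothness E tau / tau| < e / (2 * `|y|).
    near (0:R)^'+ => tau; exists tau; split; near: tau; first exact: nbhs_right_gt.
    exact: H.
  by exists tau; split => //; move: H2; rewrite sub0r normrN ltr_norml => /andP[].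
exists (tau * `|x| / `|y|); first by rewrite divr_gt0// mulr_gt0.
have : (`| `|x|^-1 *: x + (tau / `|y|) *: y| +
        `| `|x|^-1 *: x - (tau / `|y|) *: y|) / 2 - 1 <= modulus_smoothness E tau.
  apply: sup_ubound; last first.
    exists (`|x|^-1 *: x, (tau / `|y|) *: y) => //=; split.
      by rewrite normrZ normfV normr_id mulVf// gt_eqF.
    by rewrite normrZ normrM normfV normr_id divfK ?gt_eqF// gtr0_norm.
  (* By the triangle inequality [tau] bounds the set, so its [sup] is a genuine supremum. *)
  exists tau => _ [[p1 p2]/= [p11 p2t] <-].
  by have := ler_normD p1 p2; have := ler_normB p1 p2; lra.
move: Htau; rewrite ltr_pdivrMr// => Htau.
have scl (s : R) : `|x + s *: ((tau * `|x| / `|y|) *: y)| =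
    `|x| * `| `|x|^-1 *: x + s *: ((tau / `|y|) *: y)|.
  have nxZ w : `|x| * `|w| = `| `|x| *: w| by rewrite normrZ normr_id.
  rewrite nxZ scalerDr !scalerA; congr `|_ + _|.
    by rewrite divff ?scale1r ?gt_eqF.
  by congr (_ *: _); ring.
have := scl 1; rewrite !scale1r => ->; have := scl (-1); rewrite !scaleN1r => -> H.
rewrite -mulrDr.
have -> : e * (tau * `|x| / `|y|) = `|x| * (2 * (e / (2 * `|y|) * tau)).
  by field; rewrite !gt_eqF.
rewrite [2 * _]mulrC -mulrDr ler_pM2l//.
by lra.
Unshelve. all: by end_near. Qed.

Definition norm_slope x y t : R := (`|x + t *: y| - `|x|) / t.

(* By smoothness this one-sided derivative is linear in [y]; multiplied by [|x|]
   it is the value [J x y], so the Hahn-Banach theorem is not needed. *)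
Definition norm_deriv x y : R :=
  inf [set norm_slope x y t | t in [set t | 0 < t]].

Lemma norm_slope_ge x y t : 0 < t -> - `|y| <= norm_slope x y t.
Proof.
move=> t0; rewrite ler_pdivlMr// mulNr.
have := ler_normB (x + t *: y) (t *: y); rewrite addrK normrZ gtr0_norm//; lra.
Qed.

Lemma norm_deriv_le x y t : 0 < t -> norm_deriv x y <= norm_slope x y t.
Proof.
move=> t0; apply: ge_inf; last by exists t.
by exists (- `|y|) => _ [s s0 <-]; exact: norm_slope_ge.
Qed.

Lemma norm_deriv_ge x y (a : R) : (forall t, 0 < t -> a <= norm_slope x y t) ->
  a <= norm_deriv x y.
Proof.
move=> ha; apply: lb_le_inf; first by exists (norm_slope x y 1); exists 1 => /=.
by move=> _ [s s0 <-]; exact: ha.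
Qed.

(** Convexity of the norm: [x + s *: y] lies on the segment from [x] to [x + t *: y]. Hence the
    infimum in [norm_deriv] is the limit as the step shrinks. *)
Lemma norm_slope_homo x y s t : 0 < s -> s <= t ->
  norm_slope x y s <= norm_slope x y t.
Proof.
move=> s0 st; have t0 : 0 < t by exact: lt_le_trans st.
rewrite ler_pdivrMr// lerBlDr.
have -> : x + s *: y = (1 - s / t) *: x + (s / t) *: (x + t *: y).
  by rewrite scalerDr scalerA divfK ?gt_eqF// scalerBl scale1r addrA subrK.
apply: le_trans (ler_normD _ _) _; rewrite (normrZ _ x) (normrZ _ (x + _)).
have st1 : s / t <= 1 by rewrite ler_pdivrMr// mul1r.
have st0 : 0 <= s / t by rewrite divr_ge0// ltW.
rewrite !ger0_norm ?subr_ge0//.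
by rewrite /norm_slope le_eqVlt; apply/orP; left; apply/eqP; field; rewrite gt_eqF.
Qed.

Lemma norm_derivD_le x y z :
  norm_deriv x (y + z) <= norm_deriv x y + norm_deriv x z.
Proof.
rewrite -lerBlDr; apply: norm_deriv_ge => t t0.
rewrite lerBlDr [leRHS]addrC -lerBlDr; apply: norm_deriv_ge => s s0.
rewrite lerBlDr.
(* The step [2 * m] is below both [s] and [t], and [x + m *: (y + z)] is the midpoint of
   [x + (2 * m) *: z] and [x + (2 * m) *: y]. *)
pose m := Num.min s t / 2.
have m0 : 0 < m by rewrite divr_gt0// lt_min s0.
have ms : 2 * m <= s by rewrite mulrC divfK// ge_min lexx.
have mt : 2 * m <= t by rewrite mulrC divfK// ge_min lexx orbT.
have m20 : 0 < 2 * m by rewrite mulr_gt0.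
have := norm_slope_homo x y m20 mt; have := norm_slope_homo x z m20 ms.
have := norm_deriv_le x (y + z) m0.
suff : norm_slope x (y + z) m <= norm_slope x z (2 * m) + norm_slope x y (2 * m).
  lra.
rewrite /norm_slope -mulrDl ler_pdivrMr// mulrAC -[leRHS]mulrA.
have -> : m / (2 * m) = 2^-1 by field; rewrite gt_eqF.
have -> : x + m *: (y + z) =
    2^-1 *: ((x + (2 * m) *: z) + (x + (2 * m) *: y)).
  rewrite !scalerDr !scalerA mulrA mulVf// mul1r.
  rewrite addrACA -scalerDl (_ : 2^-1 + 2^-1 = 1); last by field.
  by rewrite scale1r (addrC (m *: y)).
rewrite normrZ normfV ger0_norm//.
by have := ler_normD (x + (2 * m) *: z) (x + (2 * m) *: y); lra.
Qed.

Lemma norm_derivZ_le x y (b : R) : 0 < b ->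
  norm_deriv x (b *: y) <= b * norm_deriv x y.
Proof.
move=> b0; rewrite -ler_pdivrMl//; apply: norm_deriv_ge => t t0.
rewrite ler_pdivrMl//.
have tb0 : 0 < t / b by exact: divr_gt0.
apply: le_trans (norm_deriv_le _ _ tb0) _.
rewrite /norm_slope scalerA divfK ?gt_eqF// le_eqVlt; apply/orP; left.
by apply/eqP; field; rewrite !gt_eqF.
Qed.

Lemma norm_deriv_le_norm x y : norm_deriv x y <= `|y|.
Proof.
apply: le_trans (norm_deriv_le _ _ ltr01) _.
by rewrite /norm_slope divr1 scale1r lerBlDr addrC ler_normD.
Qed.

Lemma norm_deriv0 x : norm_deriv x 0 = 0.
Proof.
apply/eqP; rewrite eq_le; apply/andP; split.
  by rewrite -[leRHS](@normr0 _ E) norm_deriv_le_norm.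
by apply: norm_deriv_ge => t t0; rewrite /norm_slope scaler0 addr0 subrr mul0r.
Qed.

Lemma norm_deriv_self x : norm_deriv x x = `|x|.
Proof.
apply/eqP; rewrite eq_le norm_deriv_le_norm; apply: norm_deriv_ge => t t0.
rewrite ler_pdivlMr// -{2}(scale1r x) -scalerDl normrZ ger0_norm; last lra.
by rewrite mulrDl mul1r addrC addrA addNr add0r mulrC.
Qed.

Hypothesis E_smooth : uniformly_smooth E.

(** Smoothness enters here: it makes the sum of the slopes along [y] and [- y] at most [e], whereas
    convexity alone gives only a nonnegative sum. *)
Lemma norm_derivN x y : x != 0 -> norm_deriv x (- y) = - norm_deriv x y.
Proof.
move=> x0; apply/eqP; rewrite -addr_eq0 eq_le; apply/andP; split; last first.
  by rewrite -(norm_deriv0 x) -(addNr y) norm_derivD_le.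
apply/ler_addgt0Pl => e e0; rewrite addr0.
have [t t0] := smooth_norm y E_smooth x0 e0.
have := norm_deriv_le x (- y) t0; have := norm_deriv_le x y t0.
rewrite /norm_slope scalerN !ler_pdivlMr// => h1 h2 h3.
by rewrite -(ler_pM2r t0) mulrDl; lra.
Qed.

Lemma norm_derivD x y z : x != 0 ->
  norm_deriv x (y + z) = norm_deriv x y + norm_deriv x z.
Proof.
move=> x0; apply/eqP; rewrite eq_le norm_derivD_le /=.
(* By oddness, subadditivity along the opposite directions is superadditivity. *)
have := norm_derivD_le x (- y) (- z).
by rewrite -opprD !norm_derivN// -opprD lerN2.
Qed.

Lemma norm_derivZ x y (b : R) : x != 0 ->
  norm_deriv x (b *: y) = b * norm_deriv x y.
Proof.
move=> x0.
have pos (a : R) w : 0 < a -> norm_deriv x (a *: w) = a * norm_deriv x w.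
  move=> a0; apply/eqP; rewrite eq_le norm_derivZ_le//=.
  have ai0 : 0 < a^-1 by rewrite invr_gt0.
  have := norm_derivZ_le x (a *: w) ai0.
  by rewrite scalerA mulVf ?gt_eqF// scale1r ler_pdivlMl.
have [b0|b0|->] := ltgtP b 0.
- by rewrite -[b]opprK scaleNr -scalerN pos ?norm_derivN ?oppr_gt0// mulrNN opprK.
- exact: pos.
- by rewrite scale0r norm_deriv0 mul0r.
Qed.

Lemma duality_set_neq0 x : duality_set x !=set0.
Proof.
have [->|x0] := eqVneq x 0.
  by exists 0; split; rewrite ?dual_zeroE !normr0 expr0n.
have nx0 : 0 < `|x| by rewrite normr_gt0.
have [|||f fE] := @exists_dual _ E (fun y => `|x| * norm_deriv x y) `|x|.
- by move=> u v; rewrite norm_derivD// mulrDr.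
- by move=> b u; rewrite norm_derivZ// mulrCA.
- by move=> u; rewrite ler_pM2l// norm_deriv_le_norm.
have fx : f x = `|x| ^+ 2 :> R by rewrite fE norm_deriv_self expr2.
exists f; split => //; congr (_ ^+ 2); apply/eqP; rewrite eq_le; apply/andP; split.
  by apply: dual_norm_le_bound => // y; rewrite fE ler_pM2l// norm_deriv_le_norm.
by rewrite -(ler_pM2r nx0) -expr2 -fx ler_dual.
Qed.

(** Adding the norm bounds of [f] at [x + t *: y] and of [g] at [x - t *: y] leaves [t (f y - g y)]
    below [|x|] times the second difference of the norm, which smoothness makes at most [e t]. *)
Lemma duality_set_unique x (f g : dual E) :
  duality_set x f -> duality_set x g -> f = g.
Proof.
move=> [fx fn] [gx gn].
have nn (h : dual E) : `|h| ^+ 2 = `|x| ^+ 2 -> `|h| = `|x|.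
  by move/eqP; rewrite eqrXn2// => /eqP.
have [x0|x0] := eqVneq x 0.
  have := nn _ fn; have := nn _ gn; rewrite x0 normr0.
  by move=> /normr0_eq0 -> /normr0_eq0 ->.
have nx0 : 0 < `|x| by rewrite normr_gt0.
have le0 y : f y - g y <= 0 :> R.
  apply/ler_addgt0Pl => e e0; rewrite addr0.
  have ex0 : 0 < e / `|x| by exact: divr_gt0.
  have [t t0] := smooth_norm y E_smooth x0 ex0.
  rewrite -(ler_pM2l nx0) => H.
  have H1 := ler_dual f (x + t *: y); have H2 := ler_dual g (x - t *: y).
  rewrite dualD dualZ fx nn// in H1; rewrite dualB dualZ gx nn// in H2.
  have H3 : `|x| * (2 * `|x| + e / `|x| * t) = 2 * `|x| ^+ 2 + e * t.
    by field; rewrite gt_eqF.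
  rewrite H3 mulrDr in H.
  by rewrite -(ler_pM2r t0); lra.
apply: dual_ext => y; have := le0 y; have := le0 (- y); rewrite !dualN; lra.
Qed.

Lemma duality_setJ x : duality_set x (J x).
Proof. by rewrite /J; case: xgetP => // H; have [f /H] := duality_set_neq0 x. Qed.

Lemma J_self x : J x x = `|x| ^+ 2 :> R.
Proof. by have [] := duality_setJ x. Qed.

Lemma norm_J x : `|J x| = `|x|.
Proof.
have [_ /eqP] := duality_setJ x.
by rewrite eqrXn2// => /eqP.
Qed.

Lemma J_unique x (f : dual E) : f x = `|x| ^+ 2 :> R -> `|f| = `|x| -> J x = f.
Proof.
move=> fx fn; apply: (duality_set_unique (duality_setJ x)).
by split=> //; rewrite fn.
Qed.

End duality_map_exists.

(** * Convergence from bounds on squared distances *)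

Lemma squeeze_sqr_cvg0 (R : realType) (T : Type) (F : set_system T)
    {FF : ProperFilter F} (K : R) (u d : T -> R) :
  0 < K -> (forall t, 0 <= u t) -> (\forall t \near F, K * u t ^+ 2 <= d t) ->
  d @ F --> (0 : R) -> u @ F --> (0 : R).
Proof.
move=> K0 u0 ud d0; apply/cvgrPdist_lt => e e0.
have Ke : 0 < K * e ^+ 2 by rewrite mulr_gt0// exprn_gt0.
have /cvgrPdist_lt/(_ _ Ke) dK := d0.
near=> t; rewrite sub0r normrN ger0_norm//.
rewrite -(ltr_pXn2r (n := 2))// ?nnegrE ?(ltW e0)// -(ltr_pM2l K0).
apply: le_lt_trans (_ : K * u t ^+ 2 <= d t) _; first by near: t.
have : `|0 - d t| < K * e ^+ 2 by near: t; exact: dK.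
by rewrite sub0r normrN; exact: le_lt_trans (ler_norm _).
Unshelve. all: by end_near. Qed.

Lemma cvg_sqr_dist (R : realType) (V : normedModType R) (T : Type)
    (F : set_system T) {FF : ProperFilter F} (K : R)
    (u v : T -> V) (d : T -> R) (l : V) :
  0 < K -> (\forall t \near F, K * `|u t - v t| ^+ 2 <= d t) ->
  d @ F --> (0 : R) -> v @ F --> l -> u @ F --> l.
Proof.
move=> K0 uvd d0 vl; apply: cvg_zero.
have uv0 : `|u t - v t| @[t --> F] --> (0 : R).
  by apply: squeeze_sqr_cvg0 K0 _ uvd d0.
have : (u t - v t) + (v t - l) @[t --> F] --> (0 : V) + (l - l).
  by apply: cvgD; [exact/norm_cvg0P|apply: cvgB => //; exact: cvg_cst].
rewrite subrr addr0; apply: cvg_trans; apply: near_eq_cvg.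
by apply: nearW => t /=; rewrite addrA subrK.
Qed.

Lemma cauchy_sqr_dist (R : realType) (V : completeNormedModType R)
    (K : R) (u : nat -> V) (d : nat -> R) :
  0 < K -> (forall m n, K * `|u m - u n| ^+ 2 <= d m + d n) ->
  d @ \oo --> (0 : R) -> cvgn u.
Proof.
move=> K0 ud d0; apply/cauchy_cvgP/cauchyP => e e0.
have Ke : 0 < K * e ^+ 2 / 2 by rewrite divr_gt0// mulr_gt0// exprn_gt0.
have /cvgrPdist_lt/(_ _ Ke) [N _ dN] := d0.
have dNE n : (N <= n)%N -> d n < K * e ^+ 2 / 2.
  by move=> /dN /=; rewrite sub0r normrN; exact: le_lt_trans (ler_norm _).
exists (u N); exists N => // n /= Nn.
rewrite -ball_normE /= -(ltr_pXn2r (n := 2))// ?nnegrE ?(ltW e0)// -(ltr_pM2l K0).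
apply: le_lt_trans (ud _ _) _; have := dNE _ Nn; have := dNE _ (leqnn N); lra.
Qed.

(** * Continuity and surjectivity of the duality mapping *)

Section duality_map.
Context {R : realType} {E : completeNormedModType R}.
Hypothesis E_smooth : uniformly_smooth E.
Implicit Types (x y : E) (f : dual E).

(** Testing [J (u t)] at [x + s *: w] bounds its value at [w] by a difference quotient of the norm,
    and smoothness at [x] closes the gap to [J x w]. *)
Lemma J_demicontinuous (T : Type) (F : set_system T) {FF : ProperFilter F}
    (u : T -> E) x y :
  u @ F --> x -> (J (u t) y : R) @[t --> F] --> (J x y : R).
Proof.
move=> ux.
have upper w e : 0 < e -> \forall t \near F, (J (u t) w : R) < J x w + e.
  (* [smooth_norm] needs [x != 0]; at the origin [|J (u t)| = |u t|] tends to 0. *)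
  move=> e0; have [x0|x0] := eqVneq x 0.
    have un : `|u t| * `|w| @[t --> F] --> (0 : R).
      rewrite -(mul0r `|w|); apply: cvgMl; rewrite -(@normr0 _ E) -x0.
      exact: cvg_norm.
    have -> : J x w = 0 :> R.
      apply/eqP; rewrite -normr_le0; apply: le_trans (ler_dual_norm _ _) _.
      by rewrite norm_J// x0 normr0 mul0r.
    near=> t; rewrite add0r; apply: le_lt_trans (ler_dual _ _) _; rewrite norm_J//.
    near: t; apply: cvgr_lt un _ e0.
  have nx0 : 0 < `|x| by rewrite normr_gt0.
  have e'0 : 0 < e / (2 * `|x|) by rewrite divr_gt0// mulr_gt0.
  have [s s0 Hs] := smooth_norm w E_smooth x0 e'0.
  have lim : `|u t| * (`|x + s *: w| - `|u t| + `|u t - x|) @[t --> F] -->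
      `|x| * (`|x + s *: w| - `|x| + 0).
    apply: cvgM; first exact: cvg_norm.
    apply: cvgD; first by apply: cvgB; [exact: cvg_cst|exact: cvg_norm].
    rewrite -(@normr0 _ E) -(subrr x); apply: cvg_norm.
    by apply: cvgB => //; exact: cvg_cst.
  have bound : `|x| * (`|x + s *: w| - `|x| + 0) < s * (J x w + e).
    have := ler_dual (J x) (x - s *: w).
    rewrite dualB dualZ J_self// norm_J// => H1.
    rewrite addr0; move: Hs; rewrite -(ler_pM2l nx0) !mulrDr.
    have -> : `|x| * (e / (2 * `|x|) * s) = e * s / 2.
      by field; rewrite gt_eqF.
    have := mulr_gt0 e0 s0; lra.
  near=> t; rewrite -(ltr_pM2l s0).
  apply: le_lt_trans (_ : `|u t| * (`|x + s *: w| - `|u t| + `|u t - x|) < _).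
    have := ler_dual (J (u t)) (x + s *: w); have := ler_dual (J (u t)) (u t - x).
    rewrite dualB dualD dualZ J_self// norm_J//; lra.
  by near: t; apply: cvgr_lt bound.
apply/cvgrPdist_lt => e e0; near=> t; rewrite ltr_norml.
have : J (u t) y < J x y + e :> R by near: t; exact: upper.
(* The upper bound along [- y] is the lower bound along [y]. *)
have : J (u t) (- y) < J x (- y) + e :> R by near: t; exact: upper.
rewrite !dualN; lra.
Unshelve. all: by end_near. Qed.

Hypothesis E_convex : two_uniformly_convex E.

Lemma exists_norming f (e : R) : f != 0 -> 0 < e ->
  exists2 x, `|x| = 1 & `|f| - e < (f x : R).
Proof.
move=> f0 e0; have nf0 : 0 < `|f| by rewrite normr_gt0.
(* Capping the error by [|f|] forces [f y] to be nonzero, so [y] can be normalized with the sign of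
   [f y]; since [|y| <= 1], normalizing does not decrease the value. *)
have m0 : 0 < Num.min e `|f| by rewrite lt_min e0.
have [_ [y /= y1 <-] Hy] := sup_adherent m0 (dual_norm_has_sup f).
have {}Hy : `|f| - Num.min e `|f| < `|f y : R| by [].
have fy0 : 0 < `|f y : R|.
  by apply: le_lt_trans Hy; rewrite subr_ge0 ge_min lexx orbT.
have y0 : y != 0 by apply: contraTneq fy0 => ->; rewrite dual0 normr0 ltxx.
have ny0 : 0 < `|y| by rewrite normr_gt0.
exists ((Num.sg (f y : R) / `|y|) *: y).
  rewrite normrZ normrM normfV normr_id normr_sg.
  by rewrite -normr_gt0 fy0 mul1r mulVf// gt_eqF.
rewrite dualZ mulrAC -[Num.sg _ * _]normrEsg ltr_pdivlMr//.
apply: le_lt_trans (_ : `|f| - Num.min e `|f| < _) => //.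
have : `|f| - e <= `|f| - Num.min e `|f|.
  by rewrite lerD2l lerN2 ge_min lexx.
have : 0 <= `|f| - Num.min e `|f| by rewrite subr_ge0 ge_min lexx orbT.
nra.
Qed.

Lemma two_uniformly_convex_norm : exists2 k : R, 0 < k &
  forall x y, `|x| = 1 -> `|y| = 1 -> k * `|x - y| ^+ 2 <= 1 - `|2^-1 *: (x + y)|.
Proof.
have [k k0 Hk] := E_convex; exists k => // x y x1 y1.
have [->|xy] := eqVneq x y.
  have -> : 2^-1 *: (y + y) = y.
    by rewrite -(mulr2n y) -(scaler_nat 2 y) scalerA mulVf// scale1r.
  by rewrite subrr normr0 expr0n mulr0 y1 subrr.
rewrite -lee_fin; apply: le_trans (Hk _ _ _) _.
- by rewrite normr_gt0 subr_eq0.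
- by apply: le_trans (ler_normB _ _) _; rewrite x1 y1.
- by apply: ereal_inf_lbound; exists (x, y).
Qed.

(** Uniform convexity replaces weak compactness: midpoints of unit vectors that nearly norm [f] also
    nearly norm [f], so they have norm near 1 and the vectors form a Cauchy sequence. *)
Lemma norm_attained f : f != 0 -> exists2 x, `|x| = 1 & f x = `|f| :> R.
Proof.
move=> f0; have nf0 : 0 < `|f| by rewrite normr_gt0.
have [k k0 Hk] := two_uniformly_convex_norm.
have /choice[u uP] : forall n : nat, exists x,
    `|x| = 1 /\ `|f| - n.+1%:R^-1 < (f x : R).
  move=> n; have [//||x x1 fx] := @exists_norming f n.+1%:R^-1; last by exists x.
  by rewrite invr_gt0.
have inv0 : (n.+1%:R^-1 : R) @[n --> \oo] --> (0 : R) by exact: cvg_harmonic.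
(* The constant comes from [f (u i) + f (u j) <= 2 |f| (1 - k |u i - u j|^2)], set against the lower
   bound [2 |f| - 1/(i+1) - 1/(j+1)]. *)
have K0 : 0 < 2 * `|f| * k by rewrite !mulr_gt0.
have /cvg_ex[x ux] : cvgn u.
  apply: (cauchy_sqr_dist K0 _ inv0) => i j.
  have [ui fi] := uP i; have [uj fj] := uP j.
  have := Hk _ _ ui uj; rewrite -(ler_pM2l nf0).
  have := ler_dual f (2^-1 *: (u i + u j)); rewrite dualZ dualD; move: fi fj.
  move: (f (u i) : R) (f (u j) : R) (i.+1%:R^-1 : R) (j.+1%:R^-1 : R) => F1 F2 e1 e2.
  move: (`|2^-1 *: _|) (`|_ - _|) (`|f|) => B D N.
  lra.

have x1 : `|x| = 1.
  have : `|u n| @[n --> \oo] --> `|x| by exact: cvg_norm.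
  rewrite (_ : (fun n => `|u n|) = cst 1); last first.
    by apply/funext => n; exact: (uP n).1.
  by move=> /(cvg_unique (@norm_hausdorff _ R^o)); apply; exact: cvg_cst.
exists x => //; apply/eqP; rewrite eq_le; apply/andP; split.
  by rewrite -[leRHS]mulr1 -x1 ler_dual.
have lim : `|f| - n.+1%:R^-1 @[n --> \oo] --> `|f| - 0.
  by apply: cvgB => //; exact: cvg_cst.
rewrite subr0 in lim.
apply: ler_cvg_to lim (dual_cvg (f := f) ux) _; apply: nearW => n.
by apply/ltW; exact: (uP n).2.
Qed.

Lemma J_surj f : exists x, J x = f.
Proof.
have [->|f0] := eqVneq f 0.
  by exists 0; apply/eqP; rewrite -normr_le0 norm_J// normr0.
have [x x1 fx] := norm_attained f0; exists (`|f| *: x); apply: J_unique => //.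
  by rewrite dualZ fx normrZ normr_id x1 mulr1 expr2.
by rewrite normrZ normr_id x1 mulr1.
Qed.

Lemma JinvK f : J (Jinv f) = f.
Proof. by rewrite /Jinv; case: xgetP => [x _ //|H]; have [x /H] := J_surj f. Qed.

End duality_map.

(** * Convex combinations with a real parameter *)

Lemma convex_setE (R : numDomainType) (M : lmodType R) (A : set M) x y (t : R) :
  convex_set A -> A x -> A y -> 0 <= t -> t <= 1 -> A (t *: x + (1 - t) *: y).
Proof.
move=> cA Ax Ay t0 t1; have := cA x y (Itv01 t0 t1).
by rewrite !inE => /(_ Ax Ay).
Qed.

Lemma convex_functionE (R : numFieldType) (M : lmodType R) (A : set M)
    (f : M -> R) x y (t : R) :
  convex_function A f -> A x -> A y -> 0 <= t -> t <= 1 ->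
  f (t *: x + (1 - t) *: y) <= t * f x + (1 - t) * f y.
Proof.
move=> cf Ax Ay t0 t1; have := cf (Itv01 t0 t1) x y.
by rewrite !inE => /(_ Ax Ay).
Qed.

(** * Identities, continuity and strong convexity of [phi] *)

Section phi_theory.
Context {R : realType} {E : completeNormedModType R}.
Hypothesis E_smooth : uniformly_smooth E.
Implicit Types (x y z p : E) (f g : dual E).

Lemma phiE x y : phi x y = `|x| ^+ 2 - 2 * (J y x : R) + `|y| ^+ 2.
Proof. by []. Qed.

Lemma phi_self x : phi x x = 0.
Proof. by rewrite phiE J_self//; lra. Qed.

Lemma phi_ge0 x y : 0 <= phi x y.
Proof.
have := ler_dual (J y) x; rewrite norm_J// phiE => H.
by have := sqr_ge0 (`|x| - `|y|); nra.
Qed.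

Lemma phi_three_point x y z :
  phi x y = phi x z + phi z y + 2 * ((J z - J y) (x - z) : R).
Proof. rewrite !phiE dualB !dual_subE J_self//; ring. Qed.

(** The left side minus [phi p z] does not depend on [p], since both equal [|p|^2 - 2 J z p] up to
    constants; its value is read off at [p = z]. *)
Lemma phi_conv2 (a : R) x y z p : J z = a *: J x + (1 - a) *: J y ->
  a * phi p x + (1 - a) * phi p y =
  phi p z + a * phi z x + (1 - a) * phi z y.
Proof.
move=> Jz.
have Jzp v : J z v = a * (J x v : R) + (1 - a) * (J y v : R) :> R by rewrite Jz.
have := Jzp z; rewrite J_self// => zz.
rewrite !phiE Jzp; ring: zz.
Qed.

Lemma phi_convn n (a : 'I_n -> R) (u : 'I_n -> E) z p :
  \sum_(i < n) a i = 1 -> J z = \sum_(i < n) a i *: J (u i) ->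
  \sum_(i < n) a i * phi p (u i) = phi p z + \sum_(i < n) a i * phi z (u i).
Proof.
move=> a1 Jz.
have Jzp v : J z v = \sum_(i < n) a i * (J (u i) v : R) :> R by rewrite Jz dual_sumE.
have sumE v : \sum_(i < n) a i * phi v (u i) =
    `|v| ^+ 2 - 2 * (J z v : R) + \sum_(i < n) a i * `|u i| ^+ 2.
  have -> : `|v| ^+ 2 = \sum_(i < n) a i * `|v| ^+ 2 by rewrite -mulr_suml a1 mul1r.
  rewrite Jzp mulr_sumr.
  rewrite -sumrB -big_split /=; apply: eq_bigr => i _; rewrite phiE; ring.
rewrite !sumE !phiE J_self//; ring.
Qed.

Lemma phi_cvgr (T : Type) (F : set_system T) {FF : ProperFilter F} (u : T -> E) x p :
  u @ F --> x -> phi p (u t) @[t --> F] --> phi p x.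
Proof.
move=> ux; apply: cvgD; last first.
  by rewrite expr2; under eq_fun do rewrite expr2; apply: cvgM; exact: cvg_norm.
apply: cvgB; first exact: cvg_cst.
apply: cvgM; first exact: cvg_cst.
exact: J_demicontinuous.
Qed.

Lemma phi_cvgl (T : Type) (F : set_system T) {FF : ProperFilter F} (u : T -> E) x y :
  u @ F --> x -> phi (u t) y @[t --> F] --> phi x y.
Proof.
move=> ux; apply: cvgD; last exact: cvg_cst.
apply: cvgB.
  by rewrite expr2; under eq_fun do rewrite expr2; apply: cvgM; exact: cvg_norm.
by apply: cvgM; [exact: cvg_cst|exact: dual_cvg].
Qed.

(** Demicontinuity concerns a fixed vector, so the moving argument is split as [(v t - y) + y]; the
    first part vanishes because [|J (u t)| = |u t|] converges. *)
Lemma J_pairing_cvg (T : Type) (F : set_system T) {FF : ProperFilter F}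
    (u v : T -> E) x y :
  u @ F --> x -> v @ F --> y -> (J (u t) (v t) : R) @[t --> F] --> (J x y : R).
Proof.
move=> ux vy.
have diff0 : (J (u t) (v t - y) : R) @[t --> F] --> (0 : R).
  apply/norm_cvg0P.
  have ub : `|u t| * `|v t - y| @[t --> F] --> (0 : R).
    rewrite -(mulr0 `|x|); apply: cvgM; first exact: cvg_norm.
    rewrite -(@normr0 _ E) -(subrr y); apply: cvg_norm.
    by apply: cvgB => //; exact: cvg_cst.
  apply: squeeze_cvgr _ (cvg_cst (0 : R)) ub; apply: nearW => t.
  by rewrite normr_ge0 -(norm_J E_smooth (u t)) ler_dual_norm.
have -> : (fun t => J (u t) (v t) : R) =
    (fun t => (J (u t) (v t - y) : R) + (J (u t) y : R)).
  by apply/funext => t; rewrite dualB subrK.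
rewrite -[X in _ --> X]add0r.
exact: cvgD diff0 (J_demicontinuous E_smooth (y := y) ux).
Qed.

Hypothesis E_convex : two_uniformly_convex E.

(* A conjugate argument: [2 f u - |u|^2 <= |f|^2] for [u = Jinv (f + g)] bounds
   the growth of the squared dual norm from [f] to [f + g]. *)
Lemma phi_ge_of_J_lipschitz (L : R) x y : 0 < L ->
  (forall u v : E, `|u - v| <= L * `|J u - J v|) ->
  (2 * L)^-1 * `|x - y| ^+ 2 <= phi x y.
Proof.
move=> L0 HL.
(* For [g = s J (x - y)] the argument gives the coefficient [2 s - 2 L s^2], which is largest at
   [s = (2 L)^-1]. *)
pose g := (2 * L)^-1 *: J (x - y).
pose u := Jinv (J y + g).
have Ju : J u = J y + g by exact: JinvK.
have ng : `|g| = (2 * L)^-1 * `|x - y|.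
  by rewrite normrZ norm_J// ger0_norm// invr_ge0 mulr_ge0// ltW.
have gxy : g (x - y) = (2 * L)^-1 * `|x - y| ^+ 2 :> R.
  by rewrite dual_scaleE J_self.
have uy : `|u - y| <= L * `|g|.
  by have := HL u y; rewrite Ju [J y + g]addrC addrK.
have guy : g (u - y) <= (2 * L)^-1 * `|x - y| ^+ 2 / 2 :> R.
  apply: le_trans (ler_dual _ _) _; have := ler_wpM2l (normr_ge0 g) uy.
  move/le_trans; apply; rewrite ng le_eqVlt; apply/orP; left; apply/eqP.
  by field; rewrite gt_eqF.
have h1 := phi_ge0 u y; have h2 := phi_ge0 x u.
have Juu : J y u = `|u| ^+ 2 - (g u : R) :> R.
  by rewrite -(J_self E_smooth) Ju dual_addE addrK.
rewrite phiE Juu in h1; rewrite phiE Ju dual_addE in h2.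
move: gxy guy; rewrite !dualB phiE; lra.
Qed.

End phi_theory.

(** * The generalized projection onto a closed convex set *)

Section generalized_projection.
Context {R : realType} {E : completeNormedModType R}.
Hypothesis E_smooth : uniformly_smooth E.
Variable mu : R.
Hypothesis mu_gt0 : 0 < mu.
Hypothesis phi_ge : forall x y : E, mu * `|x - y| ^+ 2 <= phi x y.
Variable K : set E.
Hypotheses (K_neq0 : K !=set0) (K_closed : closed K) (K_convex : convex_set K).
Implicit Types (x y z : E).

(** A minimizing sequence is Cauchy. When [phi (u i) y] and [phi (u j) y] are expanded about the
    midpoint [w], the pairings cancel in the sum, [phi w y] is at least the infimum, and
    [phi (u i) w] and [phi (u j) w] are each at least [mu / 4] times the squared distance. *)
Lemma phi_minimizer y : exists x, K x /\ forall z, K z -> phi x y <= phi z y.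
Proof.
pose S := [set phi z y | z in K].
have infS : has_inf S.
  split; first by have [z Kz] := K_neq0; exists (phi z y); exists z.
  by exists 0 => _ [z _ <-]; exact: phi_ge0.
have /choice[u uP] : forall n : nat, exists x, K x /\ phi x y < inf S + n.+1%:R^-1.
  move=> n; have n0 : 0 < n.+1%:R^-1 :> R by rewrite invr_gt0.
  by have [_ [x Kx <-] Hx] := inf_adherent n0 infS; exists x.
have inv0 : (n.+1%:R^-1 : R) @[n --> \oo] --> (0 : R) by exact: cvg_harmonic.
have infle z : K z -> inf S <= phi z y.
  by move=> Kz; apply: ge_inf; [case: infS|exists z].
have mu2 : 0 < mu / 2 by exact: divr_gt0.
have /cvg_ex[x ux] : cvgn u.
  apply: (cauchy_sqr_dist mu2 _ inv0) => i j.
  have [Ki fi] := uP i; have [Kj fj] := uP j.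
  have h0 : (0 : R) <= 2^-1 by rewrite invr_ge0.
  have h1 : 2^-1 <= 1 :> R by rewrite invf_le1// ler1n.
  have := infle _ (convex_setE K_convex Ki Kj h0 h1).
  set w := (X in phi X y).
  have half v : v = 2^-1 *: v + 2^-1 *: v :> E.
    by rewrite -scalerDl (_ : 2^-1 + 2^-1 = 1) ?scale1r//; field.
  have wE : w = 2^-1 *: u i + 2^-1 *: u j.
    by rewrite /w (_ : 1 - 2^-1 = 2^-1)//; field.
  have wi : u i - w = 2^-1 *: (u i - u j).
    by rewrite wE {1}(half (u i)) opprD addrACA subrr add0r scalerBr.
  have wj : u j - w = - (u i - w).
    rewrite wi wE {1}(half (u j)) opprD addrACA subrr addr0 -scalerBr.
    by rewrite -scalerN opprB.
  have := phi_ge (u i) w; have := phi_ge (u j) w.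
  rewrite (phi_three_point E_smooth (u i) y w) in fi.
  rewrite (phi_three_point E_smooth (u j) y w) wj dualN in fj.
  rewrite wj normrN wi normrZ ger0_norm// exprMn; move: fi fj; rewrite wi.
  move: (_ (_ *: _) : R) (`|_ - _| ^+ 2) (phi _ _) (phi _ _) (phi _ _) (inf S).
  move: (i.+1%:R^-1 : R) (j.+1%:R^-1 : R) => *; lra.
exists x; split.
  by apply: (closed_cvg _ K_closed _ _ ux); apply: nearW => n; exact: (uP n).1.
move=> z Kz; apply: le_trans (infle _ Kz).
have lim : inf S + n.+1%:R^-1 @[n --> \oo] --> inf S + 0.
  by apply: cvgD => //; exact: cvg_cst.
rewrite addr0 in lim.
apply: ler_cvg_to (phi_cvgl (y := y) ux) lim _; apply: nearW => n.
by apply/ltW; exact: (uP n).2.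
Qed.

Lemma gprojP y : K (gproj K y) /\ forall z, K z -> phi (gproj K y) y <= phi z y.
Proof. by rewrite /gproj; case: xgetP => // H; have [x /H] := phi_minimizer y. Qed.

(** First-order optimality along the segment from the projection to [z]: the three-point identity
    gives the inequality with [J] taken at the nearby point [v n], and demicontinuity carries it to
    the projection. *)
Lemma gproj_variational y z : K z ->
  0 <= ((J (gproj K y) - J y) (z - gproj K y) : R).
Proof.
move=> Kz; have [] := gprojP y; set x := gproj K y => Kx xmin.
pose t n : R := n.+1%:R^-1.
pose v n := x + t n *: (z - x).
have t0 n : 0 < t n by rewrite invr_gt0.
have t_cvg0 : t n @[n --> \oo] --> (0 : R) by exact: cvg_harmonic.
have vx : v n @[n --> \oo] --> x.
  rewrite -[X in _ --> X]addr0 -(scale0r (z - x)); apply: cvgD; first exact: cvg_cst.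
  by apply: cvgZr_tmp.
have Kv n : K (v n).
  have -> : v n = t n *: z + (1 - t n) *: x.
    by rewrite /v scalerBr scalerBl scale1r addrCA addrA.
  apply: convex_setE => //; first exact: ltW.
  by rewrite invf_le1// ler1n.
have pos n : 0 <= ((J (v n) - J y) (z - x) : R).
  have := phi_three_point E_smooth x y (v n); have := xmin _ (Kv n).
  have := phi_ge0 E_smooth x (v n).
  have -> : x - v n = - (t n *: (z - x)) by rewrite /v opprD addrA subrr add0r.
  rewrite dualN dualZ => h1 h2 h3.
  by rewrite -(pmulr_rge0 _ (t0 n)); lra.
have lim : ((J (v n) - J y) (z - x) : R) @[n --> \oo] --> ((J x - J y) (z - x) : R).
  by apply: cvgB; [exact: J_demicontinuous|exact: cvg_cst].
by apply: ler_cvg_to (cvg_cst (0 : R)) lim _; apply: nearW.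
Qed.

Lemma phi_gproj y z : K z -> phi z (gproj K y) + phi (gproj K y) y <= phi z y.
Proof.
move=> Kz; have := gproj_variational y Kz.
rewrite (phi_three_point E_smooth z y (gproj K y)); lra.
Qed.

End generalized_projection.

(** * Auxiliary facts on convex sets, sequences and residue classes *)

Lemma convex_setP (R : numDomainType) (M : lmodType R) (A : set M) :
  (forall x y (t : R), A x -> A y -> 0 <= t -> t <= 1 ->
    A (t *: x + (1 - t) *: y)) -> convex_set A.
Proof. by move=> cA x y t; rewrite !inE => Ax Ay; exact: cA. Qed.

Lemma mul_bounded_cvg0 (R : realType) (M : R) (s d : nat -> R) :
  (forall n, `|s n| <= M) -> d @ \oo --> (0 : R) ->
  s n * d n @[n --> \oo] --> (0 : R).
Proof.
move=> sM d0; apply/norm_cvg0P.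
have ub : M * `|d n| @[n --> \oo] --> (0 : R).
  by rewrite -(mulr0 M); apply: cvgM; [exact: cvg_cst|exact/norm_cvg0P].
apply: squeeze_cvgr _ (cvg_cst (0 : R)) ub; apply: nearW => n.
by rewrite normr_ge0 normrM ler_wpM2r.
Qed.

Lemma within_continuous_cvgn (X Y : topologicalType) (A : set X) (g : X -> Y)
    (u : nat -> X) (l : X) :
  {within A, continuous g} -> A l -> (forall n, A (u n)) ->
  u @ \oo --> l -> g (u n) @[n --> \oo] --> g l.
Proof.
move=> gc Al Au ul V /gc; rewrite /nbhs /= -(nbhs_subspace_in Al) /within /= => H.
have /= := ul _ H; rewrite /nbhs /= /fmap /=.
by apply: filterS => n; apply.
Qed.

Lemma limn_inf_gt0_near (R : realType) (u : R^o^nat) :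
  (forall n, 0 <= u n) -> (forall n, u n <= 1) -> 0 < limn_inf u ->
  exists2 e, 0 < e & \forall n \near \oo, e <= u n.
Proof.
move=> u0 u1; rewrite limn_infE; last first.
  exists 1; split => // M M1 n _ /=; rewrite ger0_norm//.
  exact: le_trans (ltW M1).
move=> /sup_gt[|_ [N _ <-] uN]; first by exists (infs u 0%N); exists 0%N.
exists (infs u N) => //; exists N => // n /= Nn.
by apply: ge_inf; [exists 0 => _ [k _ <-]|exists n].
Qed.

Lemma cvgn_modn_subseq (T : topologicalType) (m i : nat) (u : nat -> T) (l : T) :
  (0 < m)%N -> u @ \oo --> l -> u (k * m + i)%N @[k --> \oo] --> l.
Proof.
move=> m0 ul; apply: (cvg_comp (fun k => k * m + i)%N u) ul.
move=> V [N _ NV]; exists N => // n /= Nn; apply: NV => /=.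
by rewrite (leq_trans Nn)// (leq_trans _ (leq_addr _ _))// leq_pmulr.
Qed.

Lemma cyc_modn (m : nat) (m_gt0 : (0 < m)%N) (i : 'I_m) k :
  cyc m_gt0 (k * m + i)%N = i.
Proof. by apply: val_inj; rewrite /= modnMDl modn_small. Qed.

(** * Single steps of the iteration and passage to the limit *)

Section iteration_steps.
Context {R : realType} {E : completeNormedModType R}.
Hypothesis E_smooth : uniformly_smooth E.
Hypothesis E_convex : two_uniformly_convex E.
Variable mu : R.
Hypothesis mu_gt0 : 0 < mu.
Hypothesis phi_ge : forall x y : E, mu * `|x - y| ^+ 2 <= phi x y.
Variable C : set E.
Hypotheses (C_closed : closed C) (C_convex : convex_set C).
Implicit Types (x y z p : E) (A B : E -> dual E).

Lemma inverse_strongly_monotone_lipschitz A (g : R) x y : 0 < g ->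
  inverse_strongly_monotone C g A -> C x -> C y ->
  `|A x - A y| <= g^-1 * `|x - y|.
Proof.
move=> g0 ism Cx Cy; have := ism _ _ Cx Cy; have := ler_dual (A x - A y) (x - y).
have := normr_ge0 (A x - A y); rewrite le_eqVlt => /predU1P[<- _ _|D0].
  by rewrite mulr_ge0// invr_ge0 ltW.
move=> h1 h2; rewrite ler_pdivlMl// -(ler_pM2l D0).
by apply: le_trans h1; apply: le_trans h2; rewrite expr2 mulrCA.
Qed.

(** [phi z x] supplies [mu |x - z|^2], and the cross term of the three-point identity is at least
    [- 2 lam A x (p - z)], which costs at most [lam / (2 g) |x - z|^2]. The net coefficient is
    positive exactly when [lam < 2 g mu]. *)
Lemma phi_forward_step A (g lam : R) x p z : 0 < g -> 0 <= lam ->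
  inverse_strongly_monotone C g A -> VI C A p -> C x ->
  z = gproj C (Jinv (J x - lam *: A x)) ->
  phi p z + (mu - lam / (2 * g)) * `|x - z| ^+ 2 <= phi p x.
Proof.
move=> g0 lam0 ism [Cp VIp] Cx zE.
have C0 : C !=set0 by exists p.
have Cz : C z.
  by rewrite zE; exact: (gprojP E_smooth mu_gt0 phi_ge C0 C_closed C_convex _).1.
have := gproj_variational E_smooth mu_gt0 phi_ge C0 C_closed C_convex
  (Jinv (J x - lam *: A x)) Cp.
rewrite -zE JinvK// !dual_subE dual_scaleE => var.
have := phi_three_point E_smooth p x z; rewrite dual_subE => ->.
have := phi_ge z x; rewrite distrC => phizx.
have h1 := ism _ _ Cx Cp; have h2 := VIp _ Cz.
have h3 := ler_dual (A x - A p) (x - z).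
have eq : A x (p - z) = ((A x - A p) (x - z) : R) - ((A x - A p) (x - p) : R)
    - (A p (z - p) : R) :> R.
  by rewrite !dual_subE !dualB; ring.
have amgm : `|A x - A p| * `|x - z| - g * `|A x - A p| ^+ 2 <=
    `|x - z| ^+ 2 / (4 * g).
  rewrite ler_pdivlMr; last by rewrite mulr_gt0.
  have := sqr_ge0 (2 * g * `|A x - A p| - `|x - z|); lra.
have {h1 h2 h3 eq} le1 : A x (p - z) <= `|x - z| ^+ 2 / (4 * g) :> R.
  by rewrite eq; move: h1 h2 h3 amgm; lra.
have := ler_wpM2l lam0 le1; rewrite [leRHS]mulrCA.
have -> : lam / (2 * g) = 2 * (lam / (4 * g)) by field; rewrite gt_eqF.
move: var phizx.
move: (lam / (4 * g)) (`|_ - _| ^+ 2) (A x _ : R) (J z _ : R) (J x _ : R).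
move=> *; lra.
Qed.

(** [GEP] at [p] tested with [u], [A2] and monotonicity give [f u p + B u (p - u) <= 0]. So the
    pairing with [J u - J y] is nonnegative, and it is the cross term of the three-point
    identity. *)
Lemma phi_resolvent_step (f : E -> E -> R) B (r : R) p u y :
  equilibrium_bifunction C f -> monotone_map C B -> GEP C f B p -> C u ->
  0 < r ->
  0 <= f u p + B u (p - u) + r^-1 * (J u - J y) (p - u) ->
  phi p u + phi u y <= phi p y.
Proof.
move=> [_ A2 _ _] mB [Cp gep] Cu r0 ineq.
have h1 := gep _ Cu; have h2 := A2 _ _ Cu Cp; have h3 := mB _ _ Cp Cu.
have : 0 <= r^-1 * ((J u - J y) (p - u) : R).
  move: h1 h2 h3 ineq; rewrite dual_subE !dualB; lra.
rewrite pmulr_rge0 ?invr_gt0// => h.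
by rewrite (phi_three_point E_smooth p y u); lra.
Qed.

Lemma J_diff_pairing_cvg0 (u v w : nat -> E) (l y : E) :
  u @ \oo --> l -> v @ \oo --> l -> w @ \oo --> y ->
  ((J (u n) - J (v n)) (w n) : R) @[n --> \oo] --> (0 : R).
Proof.
move=> ul vl wy; rewrite -(subrr (J l y : R)).
by apply: cvgB; exact: J_pairing_cvg.
Qed.

Lemma dual_pairing_cvg (g : nat -> dual E) (h : dual E) (v : nat -> E) (y : E) :
  g @ \oo --> h -> v @ \oo --> y ->
  (g n (v n) : R) @[n --> \oo] --> (h y : R).
Proof.
move=> gh vy.
have diff0 : ((g n - h) (v n) : R) @[n --> \oo] --> (0 : R).
  apply/norm_cvg0P.
  have ub : `|g n - h| * `|v n| @[n --> \oo] --> (0 : R).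
    rewrite -(mul0r `|y|); apply: cvgM; last exact: cvg_norm.
    rewrite -(@normr0 _ (dual E)) -(subrr h); apply: cvg_norm.
    by apply: cvgB => //; exact: cvg_cst.
  apply: squeeze_cvgr _ (cvg_cst (0 : R)) ub; apply: nearW => n.
  by rewrite normr_ge0 ler_dual_norm.
have -> : (fun n => g n (v n) : R) =
    (fun n => ((g n - h) (v n) : R) + (h (v n) : R)).
  by apply/funext => n; rewrite dual_subE subrK.
by rewrite -[X in _ --> X]add0r; apply: cvgD => //; exact: dual_cvg.
Qed.

(** The inequality characterizing the projection is divided by [lam n]; as [lam n >= a], the [J]
    difference still vanishes in the limit. Inverse strong monotonicity makes [A] Lipschitz on [C],
    so [A (x n)] tends to [A l]. *)
Lemma VI_limit A (g a : R) (lam : nat -> R) (x z : nat -> E) (l : E) :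
  0 < g -> inverse_strongly_monotone C g A -> 0 < a -> (forall n, a <= lam n) ->
  (forall n, C (x n)) ->
  (forall n, z n = gproj C (Jinv (J (x n) - lam n *: A (x n)))) ->
  x @ \oo --> l -> z @ \oo --> l -> VI C A l.
Proof.
move=> g0 ism a0 lam_a Cx zE xl zl.
have Cl : C l by apply: (closed_cvg _ C_closed _ _ xl); exact: nearW.
have C0 : C !=set0 by exists l.
split => // v Cv.
have vz : v - z n @[n --> \oo] --> v - l by apply: cvgB => //; exact: cvg_cst.
have Axl : A (x n) @[n --> \oo] --> A l.
  have lx : x n - l @[n --> \oo] --> (0 : E).
    by rewrite -(subrr l); apply: cvgB => //; exact: cvg_cst.
  apply: cvg_zero; apply/norm_cvg0P.
  have ub : g^-1 * `|x n - l| @[n --> \oo] --> (0 : R).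
    rewrite -(mulr0 g^-1); apply: cvgM; first exact: cvg_cst.
    exact/norm_cvg0P.
  apply: squeeze_cvgr _ (cvg_cst (0 : R)) ub; apply: nearW => n.
  by rewrite normr_ge0 inverse_strongly_monotone_lipschitz.
have lamV n : `|(lam n)^-1| <= a^-1.
  have l0 : 0 < lam n := lt_le_trans a0 (lam_a n).
  by rewrite ger0_norm ?invr_ge0 ?(ltW l0)// lef_pV2.
have lim : (lam n)^-1 * ((J (z n) - J (x n)) (v - z n) : R) +
    (A (x n) (v - z n) : R) @[n --> \oo] --> (A l (v - l) : R).
  rewrite -[X in _ --> X]add0r; apply: cvgD; last exact: dual_pairing_cvg.
  exact: mul_bounded_cvg0 lamV (J_diff_pairing_cvg0 zl xl vz).
apply: ler_cvg_to (cvg_cst (0 : R)) lim _; apply: nearW => n.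
rewrite dual_subE; have l0 : 0 < lam n := lt_le_trans a0 (lam_a n).
have := gproj_variational E_smooth mu_gt0 phi_ge C0 C_closed C_convex
  (Jinv (J (x n) - lam n *: A (x n))) Cv.
rewrite -zE JinvK// !dual_subE dual_scaleE => H.
by rewrite -(pmulr_rge0 _ l0) mulrDr mulVKf ?gt_eqF//; lra.
Qed.

(* Minty's argument: the monotone form [f v l <= B l (v - l)] is tested at
   [t v + (1 - t) l], and [t] tends to 0. *)
Lemma GEP_limit (f : E -> E -> R) B (c : R) (r : nat -> R) (u y : nat -> E) (l : E) :
  equilibrium_bifunction C f -> {within C, continuous B} ->
  0 < c -> (forall n, c <= r n) -> (forall n, C (u n)) ->
  (forall n v, C v -> 0 <= f (u n) v + B (u n) (v - u n)
     + (r n)^-1 * (J (u n) - J (y n)) (v - u n)) ->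
  u @ \oo --> l -> y @ \oo --> l -> GEP C f B l.
Proof.
move=> [A1 A2 A3 A4] Bc c0 cr Cu ineq ul yl.
have Cl : C l by apply: (closed_cvg _ C_closed _ _ ul); exact: nearW.
have Bul := within_continuous_cvgn Bc Cl Cu ul.
have rV n : `|(r n)^-1| <= c^-1.
  have r0 : 0 < r n := lt_le_trans c0 (cr n).
  by rewrite ger0_norm ?invr_ge0 ?(ltW r0)// lef_pV2.
have minty v : C v -> f v l <= B l (v - l).
  move=> Cv; rewrite leNgt; apply/negP => lt.
  (* A level strictly between the two sides: lower semicontinuity keeps [f v (u n)] above it
     eventually, while the limit of the upper bounds for [f v (u n)] lies below it. *)
  pose a : R := ((B l (v - l) : R) + f v l) / 2.
  have [af aB] : a < f v l /\ (B l (v - l) : R) < a.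
    by move: lt; rewrite /a; split; lra.
  have [_ lsc] := A4 v Cv.
  have [V Vl HV] := lsc l a (ltac:(by rewrite lte_fin)).
  have vu : v - u n @[n --> \oo] --> v - l by apply: cvgB => //; exact: cvg_cst.
  have lim : (r n)^-1 * ((J (u n) - J (y n)) (v - u n) : R) +
      (B (u n) (v - u n) : R) @[n --> \oo] --> (B l (v - l) : R).
    rewrite -[X in _ --> X]add0r; apply: cvgD; last exact: dual_pairing_cvg.
    exact: mul_bounded_cvg0 rV (J_diff_pairing_cvg0 ul yl vu).
  suff : a <= B l (v - l) by rewrite leNgt aB.
  apply: ler_cvg_to (cvg_cst a) lim _.
  move: Vl; rewrite /nbhs /= -(nbhs_subspace_in Cl) => /ul /=.
  rewrite /nbhs /=; apply: filterS => n /(_ (Cu n)) /HV; rewrite lte_fin => h.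
  have := ineq n v Cv; have := A2 _ _ Cv (Cu n); move: h => /=; lra.
split => // v Cv.
have [L limL LE] := A3 l v v Cl Cv Cv.
set b : R := B l (v - l).
(* With [w] the convex combination, [0 = f w w <= t f w v + (1 - t) f w l <= t f w v + (1 - t) t b];
   then divide by [t]. *)
have key t : 0 < t -> t < 1 -> - ((1 - t) * b) <= f (t *: v + (1 - t) *: l) v.
  move=> t0 t1.
  set w := t *: v + (1 - t) *: l.
  have Cw : C w by apply: convex_setE => //; exact: ltW.
  have wl : w - l = t *: (v - l).
    rewrite /w scalerBl scale1r scalerBr -addrA; congr (_ + _).
    by rewrite addrAC subrr add0r.
  have := minty _ Cw; rewrite wl dualZ -/b => h1.
  have := convex_functionE (A4 w Cw).1 Cv Cl (ltW t0) (ltW t1).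
  rewrite -/w (A1 _ Cw) => h2.
  have t1' : 0 <= 1 - t by rewrite subr_ge0 ltW.
  have h3 := ler_wpM2l t1' h1.
  by rewrite -(ler_pM2l t0); lra.
apply/ler_addgt0Pl => e e0.
suff : ((- b - e)%:E <= L)%E.
  by move=> /le_trans/(_ LE); rewrite lee_fin; lra.
apply: (cvge_to_ge limL); near=> t; rewrite lee_fin.
have t0 : 0 < t by near: t; exact: nbhs_right_gt.
have t1 : t < 1 by near: t; exact: nbhs_right_lt.
apply: le_trans (key _ t0 t1).
have b1 : 0 < `|b| + 1 by rewrite ltr_pwDr.
have : t < e / (`|b| + 1).
  by near: t; apply: nbhs_right_lt; exact: divr_gt0.
rewrite ltr_pdivlMr// mulrDr mulr1 => h.
have := ler_wpM2l (ltW t0) (lerNnormlW (lexx `|b|)); lra.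
Unshelve. all: by end_near. Qed.

Lemma shrinking_projection_cvg (S : set E) (x w : nat -> E) (Cn : nat -> set E) :
  S !=set0 -> S `<=` C -> Cn 0%N = C -> C (x 0%N) ->
  (forall n, Cn n.+1 = [set v | Cn n v /\ phi v (w n) <= phi v (x n)]) ->
  (forall n, x n.+1 = gproj (Cn n.+1) (x 0%N)) ->
  (forall n p, S p -> C (x n) -> phi p (w n) <= phi p (x n)) ->
  exists l, [/\ forall n, C (x n), C l, x @ \oo --> l & w @ \oo --> l].
Proof.
move=> [p0 Sp0] SC C0E x0C CnE xE Fejer.
(* All five facts must be carried together: [S] keeps [Cn n] nonempty so that the projection is
   defined, and [Fejer], which keeps [S] inside, asks for [C (x n)]. *)
have inv n : [/\ closed (Cn n), convex_set (Cn n), S `<=` Cn n, Cn n `<=` C &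
    Cn n (x n) /\
    forall v, Cn n v -> phi v (x n) + phi (x n) (x 0%N) <= phi v (x 0%N)].
  elim: n => [|n [cl cv SCn CnC [Cx _]]].
    (* [x 0] is not given as a projection; here the inequality holds because
       [phi (x 0) (x 0) = 0]. *)
    rewrite C0E; split => //; split => // v Cv.
    by rewrite phi_self// addr0.
  have cl' : closed (Cn n.+1).
    have -> : Cn n.+1 =
        Cn n `&` (fun v => phi v (x n) - phi v (w n)) @^-1` [set t | 0 <= t].
      rewrite CnE; apply/seteqP; split => v /= [? ?]; split => //.
        by rewrite subr_ge0.
      by rewrite -subr_ge0.
    apply: closedI => //; apply: preimage_closed; last exact: closed_ge.
    by move=> v _; apply: cvgB; exact: phi_cvgl.
  have cv' : convex_set (Cn n.+1).
    (* In [phi v (w n) <= phi v (x n)] the terms [|v|^2] cancel, so the condition is affine in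
       [v]. *)
    rewrite CnE; apply: convex_setP => v v' t [Cv lev] [Cv' lev'] t0 t1.
    split; first exact: convex_setE.
    have t1' : 0 <= 1 - t by rewrite subr_ge0.
    have := ler_wpM2l t0 lev; have := ler_wpM2l t1' lev'.
    rewrite !phiE !dualD !dualZ; lra.
  have S' : S `<=` Cn n.+1.
    rewrite CnE => p Sp; split; first exact: SCn.
    by apply: Fejer => //; exact: CnC.
  have C0' : Cn n.+1 !=set0 by exists p0; exact: S'.
  split => //; first by rewrite CnE => v [/CnC].
  rewrite xE; split; first exact: (gprojP E_smooth mu_gt0 phi_ge C0' cl' cv' _).1.
  move=> v Cv; exact: (phi_gproj E_smooth mu_gt0 phi_ge C0' cl' cv' (x 0%N) Cv).
have CnS n k : Cn (n + k)%N `<=` Cn n.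
  elim: k => [|k IH]; first by rewrite addn0.
  by rewrite addnS CnE => v [/IH].
have Cx n : C (x n) by have [_ _ _ + [/[swap] _]] := inv n; apply.
have step n k :
    phi (x (n + k)%N) (x n) + phi (x n) (x 0%N) <= phi (x (n + k)%N) (x 0%N).
  have [_ _ _ _ [_]] := inv n; apply; apply: (CnS n k).
  by have [_ _ _ _ []] := inv (n + k)%N.
have /cvg_ex[s ds] : cvgn (fun n => phi (x n) (x 0%N)).
  apply: nondecreasing_is_cvgn.
    move=> n k nk; have := step n (k - n)%N; rewrite subnKC//.
    by have := phi_ge0 E_smooth (x k) (x n); lra.
  exists (phi p0 (x 0%N)) => _ [n _ <-].
  have [_ _ /(_ _ Sp0) Cp0 _ [_ /(_ _ Cp0)]] := inv n.
  by have := phi_ge0 E_smooth p0 (x n); lra.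
have d0 : `|phi (x n) (x 0%N) - s| @[n --> \oo] --> (0 : R).
  rewrite -(@normr0 _ R) -(subrr s); apply: cvg_norm.
  by apply: cvgB => //; exact: cvg_cst.
(* Passing through the limit [s] turns the increment of [phi (x n) (x 0)] into a sum of one term for
   each index. *)
have dist n k : (n <= k)%N -> mu * `|x k - x n| ^+ 2 <=
    `|phi (x k) (x 0%N) - s| + `|phi (x n) (x 0%N) - s|.
  move=> nk; have := step n (k - n)%N; rewrite subnKC//.
  have := phi_ge (x k) (x n).
  have := ler_norm (phi (x k) (x 0%N) - s).
  have := ler_norm (- (phi (x n) (x 0%N) - s)); rewrite normrN; lra.
have /cvg_ex[l xl] : cvgn x.
  apply: (cauchy_sqr_dist mu_gt0 _ d0) => i j.
  have [ij|/ltnW ij] := leqP j i; first exact: dist.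
  by rewrite distrC [leRHS]addrC; exact: dist.
exists l; split => //.
  by apply: (closed_cvg _ C_closed _ _ xl); exact: nearW.
have xSl : x n.+1 @[n --> \oo] --> l by rewrite cvg_shiftS.
have dS0 : phi (x n.+1) (x 0%N) - phi (x n) (x 0%N) @[n --> \oo] --> (0 : R).
  rewrite -(subrr s); apply: cvgB => //.
  by rewrite (cvg_shiftS (fun n => phi (x n) (x 0%N))).
(* [w n] is compared with [x n.+1], which satisfies the inequality defining [Cn n.+1]. *)
apply: (cvg_sqr_dist mu_gt0 _ dS0 xSl); apply: nearW => n.
rewrite distrC; apply: le_trans (phi_ge _ _) _.
have [_ _ _ _ [+ _]] := inv n.+1; rewrite CnE => -[_ /le_trans]; apply.
by have := step n 1%N; rewrite addn1; lra.
Qed.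

End iteration_steps.


(** * Strong convergence of the iteration *)

Theorem theorem4 (R : realType) (E : completeNormedModType R)
  (E_convex : two_uniformly_convex E) (E_smooth : uniformly_smooth E)
  (C : set E) (C_neq0 : C !=set0) (C_closed : closed C) (C_convex : convex_set C)
  (q d m : nat) (d_gt0 : (0 < d)%N) (m_gt0 : (0 < m)%N)
  (f : 'I_q -> E -> E -> R)
  (f_A1234 : forall k, equilibrium_bifunction C (f k))
  (B : 'I_q -> E -> dual E)
  (B_continuous : forall k, {within C, continuous (B k)})
  (B_monotone : forall k, monotone_map C (B k))
  (T : 'I_d -> E -> E)
  (T_C : forall j, set_fun C C (T j))
  (T_continuous : forall j, {within C, continuous (T j)})
  (T_rne : forall j, relatively_nonexpansive C (T j))
  (A : 'I_m -> E -> dual E) (gamma : 'I_m -> R)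
  (gamma01 : forall i, 0 < gamma i < 1)
  (A_ism : forall i, inverse_strongly_monotone C (gamma i) (A i))
  (F : set E)
  (F_def : F = [set p | [/\ forall j, fixed_points C (T j) p,
                            forall i, VI C (A i) p &
                            forall k, GEP C (f k) (B k) p]])
  (F_neq0 : F !=set0)
  (c : R) (c01 : 0 < c < 1)
  (c_convex : forall x y : E, `|x - y| <= 2 / c ^+ 2 * `|J x - J y|)
  (r : nat -> R) (c1 : R) (c1_gt0 : 0 < c1) (r_ge : forall n, c1 <= r n)
  (beta : 'I_q -> R) (beta01 : forall k, 0 < beta k < 1)
  (beta_sum : \sum_(k < q) beta k = 1)
  (alpha : nat -> R) (alpha01 : forall n, 0 < alpha n < 1)
  (alpha_liminf : 0 < limn_inf (fun n => alpha n * (1 - alpha n)))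
  (lambda : nat -> R) (a b : R) (a_gt0 : 0 < a) (a_lt_b : a < b)
  (* the unit 1 of the minimum is harmless: 0 < m and every gamma i < 1 *)
  (b_lt : b < c ^+ 2 * (\big[Num.min/1]_(i < m) gamma i) / 2)
  (lambda_ab : forall n, a <= lambda n <= b)
  (x y z w : nat -> E) (u : 'I_q -> nat -> E) (Cn : nat -> set E)
  (C0E : Cn 0%N = C) (x0C : C (x 0%N))
  (zE : forall n, z n = gproj C
          (Jinv (J (x n) - lambda n *: A (cyc m_gt0 n) (x n))))
  (yE : forall n, y n = Jinv (alpha n *: J (x n)
          + (1 - alpha n) *: J (T (cyc d_gt0 n) (z n))))
  (uC : forall k n, C (u k n))
  (* B k is evaluated at u k n, a point of C; y n need not lie in C, on which
     alone B k is defined, so the expression B_k y_n has no meaning in general *)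
  (uE : forall k n v, C v ->
          0 <= f k (u k n) v + B k (u k n) (v - u k n)
               + (r n)^-1 * (J (u k n) - J (y n)) (v - u k n))
  (wE : forall n, w n = Jinv (\sum_(k < q) beta k *: J (u k n)))
  (CnE : forall n, Cn n.+1 = [set v | Cn n v /\ phi v (w n) <= phi v (x n)])
  (xE : forall n, x n.+1 = gproj (Cn n.+1) (x 0%N)) :
  exists2 p : E, F p & x n @[n --> \oo] --> p.
Proof.
pose gmin := \big[Num.min/1]_(i < m) gamma i.
have gmin_le i : gmin <= gamma i by exact: bigmin_le_cond.
have c2_gt0 : 0 < c ^+ 2 by rewrite exprn_gt0//; case/andP: c01.
have b_gt0 : 0 < b by exact: lt_trans a_lt_b.
have gmin_gt0 : 0 < gmin.
  have : 0 < c ^+ 2 * gmin / 2 by exact: lt_trans b_lt.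
  by rewrite pmulr_lgt0 ?invr_gt0// pmulr_rgt0.
(* This is [(2 L)^-1] for the Lipschitz constant [L = 2 / c^2] of the inverse of [J]. *)
pose mu := c ^+ 2 / 4.
have mu_gt0 : 0 < mu by rewrite divr_gt0.
have phi_ge (v v' : E) : mu * `|v - v'| ^+ 2 <= phi v v'.
  have -> : mu = (2 * (2 / c ^+ 2))^-1 by rewrite /mu invfM invf_div; lra.
  have L0 : 0 < 2 / c ^+ 2 by rewrite divr_gt0.
  exact: (phi_ge_of_J_lipschitz E_smooth E_convex v v' L0 c_convex).
(* The worst coefficient of the forward step over all [n] and [i]; the bound on [b] says
   [b < 2 gmin mu]. *)
pose eps := mu - b / (2 * gmin).
have eps_gt0 : 0 < eps.
  rewrite subr_gt0 ltr_pdivrMr ?mulr_gt0//.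
  by move: b_lt; rewrite -/gmin /mu; lra.
have lam_ge0 n : 0 <= lambda n.
  by case/andP: (lambda_ab n) => + _; apply: le_trans; exact: ltW.
have eps_le i n : eps <= mu - lambda n / (2 * gamma i).
  case/andP: (lambda_ab n) => _ lamb.
  have g0 := lt_le_trans gmin_gt0 (gmin_le i).
  rewrite lerB//; apply: ler_pM => //.
    by rewrite invr_ge0 mulr_ge0// ltW.
  by rewrite lef_pV2 ?posrE ?mulr_gt0// ler_pM2l.
have r_gt0 n : 0 < r n := lt_le_trans c1_gt0 (r_ge n).
have Cz n : C (z n).
  by rewrite zE; exact: (gprojP E_smooth mu_gt0 phi_ge C_neq0 C_closed C_convex _).1.
pose t n := T (cyc d_gt0 n) (z n).
have Ct n : C (t n) by exact: T_C.
have FC : F `<=` C.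
  move=> p; rewrite F_def => -[_ VIp _].
  by have [] := VIp (cyc m_gt0 0).
have [p0 Fp0] := F_neq0.
(* The chain runs from [x] to [z] by the forward step, to [t] by relative nonexpansiveness, to [y]
   by the convexity identity, to each [u k] by the resolvent step, and to [w] by convexity again.
   The gains stay on the left, apart from the nonnegative [sum_w]. *)
have energy p n : F p -> C (x n) ->
    phi p (w n) + \sum_(k < q) beta k * phi (u k n) (y n)
      + alpha n * phi (y n) (x n) + (1 - alpha n) * phi (y n) (t n)
      + (1 - alpha n) * (eps * `|x n - z n| ^+ 2) <= phi p (x n).
  move=> Fp Cx; have Cp := FC _ Fp.
  move: Fp; rewrite F_def => -[Fix VIp GEPp].
  have [al0 al1] := andP (alpha01 n).
  have gi := gamma01 (cyc m_gt0 n); have [gi0 _] := andP gi.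
  have step_z := phi_forward_step E_smooth E_convex mu_gt0 phi_ge C_closed C_convex
    gi0 (lam_ge0 n) (A_ism _) (VIp _) Cx (zE n).
  have step_t : phi p (t n) <= phi p (z n).
    by have [_ + _] := T_rne (cyc d_gt0 n); apply.
  have Jy : J (y n) = alpha n *: J (x n) + (1 - alpha n) *: J (t n).
    by rewrite yE JinvK.
  have step_y := phi_conv2 E_smooth p Jy.
  have step_u k : phi p (u k n) + phi (u k n) (y n) <= phi p (y n).
    exact: (phi_resolvent_step E_smooth (f_A1234 k) (B_monotone k) (GEPp k)
      (uC k n) (r_gt0 n) (uE k n p Cp)).
  have Jw : J (w n) = \sum_(k < q) beta k *: J (u k n) by rewrite wE JinvK.
  have step_w := phi_convn E_smooth p beta_sum Jw.
  have sum_w : 0 <= \sum_(k < q) beta k * phi (w n) (u k n).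
    apply: sumr_ge0 => k _; have [b0 _] := andP (beta01 k).
    by rewrite mulr_ge0 ?phi_ge0 ?ltW.
  have sum_u : \sum_(k < q) beta k * phi p (u k n) +
      \sum_(k < q) beta k * phi (u k n) (y n) <= phi p (y n).
    rewrite -big_split -[leRHS]mul1r -beta_sum mulr_suml; apply: ler_sum => k _ /=.
    by have [b0 _] := andP (beta01 k); rewrite -mulrDr ler_pM2l.
  have z_le : phi p (z n) + eps * `|x n - z n| ^+ 2 <= phi p (x n).
    apply: le_trans step_z; rewrite lerD2l.
    by apply: ler_wpM2r (eps_le _ _); exact: exprn_ge0.
  have al1' : 0 <= 1 - alpha n by rewrite subr_ge0 ltW.
  have := ler_wpM2l al1' (le_trans (lerD step_t (lexx _)) z_le).
  lra.
have gap_terms p n : F p -> C (x n) -> [/\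
    phi p (w n) <= phi p (x n),
    forall k, beta k * phi (u k n) (y n) <= phi p (x n) - phi p (w n),
    alpha n * phi (y n) (x n) <= phi p (x n) - phi p (w n),
    (1 - alpha n) * phi (y n) (t n) <= phi p (x n) - phi p (w n) &
    (1 - alpha n) * (eps * `|x n - z n| ^+ 2) <= phi p (x n) - phi p (w n)].
  move=> Fp Cx; have := energy p n Fp Cx.
  have [al0 al1] := andP (alpha01 n).
  have al1' : 0 < 1 - alpha n by rewrite subr_gt0.
  have b_ge0 k : 0 <= beta k * phi (u k n) (y n).
    by have [b0 _] := andP (beta01 k); rewrite mulr_ge0 ?phi_ge0 ?ltW.
  have s_ge0 : 0 <= \sum_(k < q) beta k * phi (u k n) (y n) by exact: sumr_ge0.
  have yx_ge0 : 0 <= alpha n * phi (y n) (x n) by rewrite mulr_ge0 ?phi_ge0 ?ltW.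
  have yt_ge0 : 0 <= (1 - alpha n) * phi (y n) (t n).
    by rewrite mulr_ge0 ?phi_ge0 ?ltW.
  have xz_ge0 : 0 <= (1 - alpha n) * (eps * `|x n - z n| ^+ 2).
    by apply: mulr_ge0; [exact: ltW|apply: mulr_ge0; [exact: ltW|exact: exprn_ge0]].
  move=> H; split; [lra| |lra|lra|lra] => k.
  have : beta k * phi (u k n) (y n) <= \sum_(k < q) beta k * phi (u k n) (y n).
    by rewrite (bigD1 k)//= lerDl; apply: sumr_ge0.
  lra.
have Fejer n p : F p -> C (x n) -> phi p (w n) <= phi p (x n).
  by move=> Fp Cx; have [] := gap_terms p n Fp Cx.
have [l [Cx Cl xl wl]] := shrinking_projection_cvg E_smooth mu_gt0 phi_ge
  C_closed C_convex F_neq0 FC C0E x0C CnE xE Fejer.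
have gap0 : phi p0 (x n) - phi p0 (w n) @[n --> \oo] --> (0 : R).
  by rewrite -(subrr (phi p0 l)); apply: cvgB; exact: phi_cvgr.
have [e e0 eN] : exists2 e, 0 < e &
    \forall n \near \oo, e <= alpha n * (1 - alpha n).
  apply: limn_inf_gt0_near => // n; have [al0 al1] := andP (alpha01 n).
    by rewrite mulr_ge0 ?subr_ge0 ?ltW.
  by nra.
(* Both factors are below 1, so a lower bound on their product bounds each of them. *)
have alpha_bounds : \forall n \near \oo, e <= alpha n /\ e <= 1 - alpha n.
  apply: filterS eN => n; have [al0 al1] := andP (alpha01 n).
  by move=> /le_trans h; split; apply: h; nra.
have zl : z @ \oo --> l.
  apply: (cvg_sqr_dist (mulr_gt0 e0 eps_gt0) _ gap0 xl).
  apply: filterS alpha_bounds => n [_ en].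
  have [_ _ _ _] := gap_terms p0 n Fp0 (Cx n); apply: le_trans.
  rewrite distrC -mulrA; apply: ler_wpM2r en.
  by apply: mulr_ge0; [exact: ltW|exact: exprn_ge0].
have yl : y @ \oo --> l.
  apply: (cvg_sqr_dist (mulr_gt0 e0 mu_gt0) _ gap0 xl).
  apply: filterS alpha_bounds => n [en _].
  have [_ _ + _ _] := gap_terms p0 n Fp0 (Cx n); apply: le_trans.
  rewrite -mulrA; apply: ler_pM (ltW e0) _ en (phi_ge _ _).
  by apply: mulr_ge0; [exact: ltW|exact: exprn_ge0].
have tl : t @ \oo --> l.
  apply: (cvg_sqr_dist (mulr_gt0 e0 mu_gt0) _ gap0 yl).
  apply: filterS alpha_bounds => n [_ en].
  have [_ _ _ + _] := gap_terms p0 n Fp0 (Cx n); apply: le_trans.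
  rewrite -mulrA distrC; apply: ler_pM (ltW e0) _ en (phi_ge _ _).
  by apply: mulr_ge0; [exact: ltW|exact: exprn_ge0].
have ul k : u k @ \oo --> l.
  have [b0 _] := andP (beta01 k).
  apply: (cvg_sqr_dist (mulr_gt0 b0 mu_gt0) _ gap0 yl); apply: nearW => n.
  have [_ + _ _ _] := gap_terms p0 n Fp0 (Cx n) => /(_ k); apply: le_trans.
  by rewrite -mulrA ler_pM2l.
exists l => //; rewrite F_def; split => [j|i|k].
- split => //.
  (* Along the indices [k * d + j] the mapping is always [T j], so [T j (z n)] tends both to [T j l]
     and to [l]. *)
  have Tz := within_continuous_cvgn (T_continuous j) Cl
    (fun k => Cz (k * d + j)%N) (cvgn_modn_subseq j d_gt0 zl).
  have := cvgn_modn_subseq j d_gt0 tl.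
  have -> : (fun k => t (k * d + j)%N) = (fun k => T j (z (k * d + j)%N)).
    by apply/funext => k; rewrite /t cyc_modn.
  exact: (cvg_unique (@norm_hausdorff _ E) Tz).
- have [gi0 _] := andP (gamma01 i).
  apply: (VI_limit E_smooth E_convex mu_gt0 phi_ge C_closed C_convex gi0 (A_ism i)
    a_gt0 (lam := fun k => lambda (k * m + i)%N) _ (fun k => Cx (k * m + i)%N)
    _ (cvgn_modn_subseq i m_gt0 xl) (cvgn_modn_subseq i m_gt0 zl)).
    by move=> k; have [] := andP (lambda_ab (k * m + i)%N).
  by move=> k; rewrite zE cyc_modn.
- exact: (GEP_limit E_smooth C_closed C_convex (f_A1234 k) (B_continuous k)
    c1_gt0 r_ge (uC k) (uE k) (ul k) yl).
Qed.
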